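(* Let $f$ be a function from $\mathbb{N}$ to the nonnegative integers and let $g_3$ be a nonnegative integer. Suppose that for every $k\in\mathbb{N}$, every graph $G$ and every set $\mathcal{A}\subseteq V(G)$, at least one of the following holds: (i) $G$ contains $k$ $\mathcal{A}$-paths $P_1,\dots,P_k$ such that $\operatorname{dist}_G(P_i,P_j)\geq 3$ for all distinct $i,j\in\{1,\dots,k\}$; or (ii) there is a set $Z\subseteq V(G)$ with $|Z|\leq f(k)$ such that $G-N_G[Z,g_3]$ has no $\mathcal{A}$-path. Then for all $k,d\in\mathbb{N}$, every graph $G$ and every set $\mathcal{A}\subseteq V(G)$, at least one of the following holds: (i') $G$ contains $k$ $\mathcal{A}$-paths $P_1,\dots,P_k$ such that $\operatorname{dist}_G(P_i,P_j)\geq d$ for all distinct $i,j\in\{1,\dots,k\}$; or (ii') there is a set $Z\subseteq V(G)$ with $|Z|\leq f(k)$ such that $G-N_G[Z,d\cdot g_3]$ has no $\mathcal{A}$-path.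
   Context: $\mathbb{N}=\{1,2,\dots\}$. Graphs are finite, simple and undirected. For a graph $G$ and $\mathcal{A}\subseteq V(G)$, an $\mathcal{A}$-path in $G$ is a path in $G$ (not necessarily induced) with at least one edge whose two endpoints belong to $\mathcal{A}$ (internal vertices may also belong to $\mathcal{A}$). For $X,Y\subseteq V(G)$, $\operatorname{dist}_G(X,Y)$ is the length (number of edges) of a shortest path in $G$ from a vertex of $X$ to a vertex of $Y$ (it is $0$ if $X\cap Y\neq\emptyset$, and $\infty$ if there is no such path); for paths $P,Q$ in $G$, $\operatorname{dist}_G(P,Q):=\operatorname{dist}_G(V(P),V(Q))$. For $Z\subseteq V(G)$ and an integer $r\geq 0$, $N_G[Z,r]$ is the set of vertices of $G$ at distance at most $r$ in $G$ from some vertex of $Z$. For $S\subseteq V(G)$, $G-S$ is the subgraph of $G$ induced by $V(G)\setminus S$. *)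

(* Defs.v *)
From mathcomp Require Import all_boot.

Set Implicit Arguments.
Unset Strict Implicit.
Unset Printing Implicit Defensive.

Record sgraph := SGraph {
  vertex :> finType;
  edge : rel vertex;
  edge_sym : symmetric edge;
  edge_irrefl : irreflexive edge }.

Definition del_edge (G : sgraph) (S : {set G}) : rel {x : G | x \notin S} :=
  fun x y => edge (val x) (val y).

Lemma del_edge_sym (G : sgraph) (S : {set G}) : symmetric (del_edge (S := S)).
Proof. by move=> x y; apply: edge_sym. Qed.

Lemma del_edge_irrefl (G : sgraph) (S : {set G}) :
  irreflexive (del_edge (S := S)).
Proof. by move=> x; apply: edge_irrefl. Qed.

(* G - S *)
Definition del_vertices (G : sgraph) (S : {set G}) : sgraph :=
  SGraph (@del_edge_sym G S) (@del_edge_irrefl G S).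

(* A :&: V(G - S), as a set of vertices of G - S *)
Definition del_set (G : sgraph) (S A : {set G}) : {set del_vertices S} :=
  [set v : del_vertices S | val v \in A].

(* A path is the nonempty sequence of its pairwise distinct vertices, in order;
   it has (size s).-1 edges. *)
Definition is_path (G : sgraph) (s : seq G) : bool :=
  if s is x :: p then path (@edge G) x p && uniq s else false.

Definition is_A_path (G : sgraph) (A : {set G}) (s : seq G) : bool :=
  if s is x :: p
  then [&& is_path s, 0 < size p, x \in A & last x p \in A]
  else false.

(* some path with exactly n edges leads from X to Y *)
Definition path_from_to (G : sgraph) (X Y : {set G}) (n : nat) : bool :=
  [exists x in X, exists p : n.-tuple G,
     is_path (x :: p) && (last x p \in Y)].

(* None stands for infinity. A path has fewer than #|G| edges, so searching the
   lengths below #|G| in increasing order finds the minimum, if any. *)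
Definition dist (G : sgraph) (X Y : {set G}) : option nat :=
  let n := find (path_from_to X Y) (iota 0 #|G|) in
  if n < #|G| then Some n else None.

Definition dist_geq (G : sgraph) (X Y : {set G}) (d : nat) : bool :=
  if dist X Y is Some n then d <= n else true.

Definition dist_leq (G : sgraph) (X Y : {set G}) (d : nat) : bool :=
  if dist X Y is Some n then n <= d else false.

(* N_G[Z, r] *)
Definition closed_nbhd (G : sgraph) (Z : {set G}) (r : nat) : {set G} :=
  [set v | [exists z in Z, dist_leq [set z] [set v] r]].

Definition has_distant_A_paths (G : sgraph) (A : {set G}) (k d : nat) : Prop :=
  exists P : 'I_k -> seq G,
    (forall i, is_A_path A (P i)) /\
    (forall i j, i != j -> dist_geq [set x in P i] [set x in P j] d).

Definition has_A_path_cover (G : sgraph) (A : {set G}) (m r : nat) : Prop :=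
  exists Z : {set G}, #|Z| <= m /\
    ~ exists s : seq (del_vertices (closed_nbhd Z r)),
        is_A_path (del_set (closed_nbhd Z r) A) s.

(* Main.v *)
Require Import Defs.
From mathcomp Require Import all_boot.
From mathcomp Require Import zify.

(** The hypothesis is applied to the [d]-th power [H] of [G], in which two
    distinct vertices are adjacent when their distance in [G] is at most [d].

    - Suppose [H] has [A]-paths at pairwise distance at least 3 in [H].  Two of
      them are more than [2 * d] apart in [G], as a walk of length at most
      [2 * d] splits into two of length at most [d] ([near_power]).  Replacing
      each edge of an [A]-path of [H] by a walk of length at most [d] in [G] and
      cutting out the cycles yields an [A]-path of [G] that stays within
      [d./2] of the original one ([A_path_of_power]).  The new paths are
      therefore more than [2 * d - 2 * d./2 >= d] apart.
    - Suppose [Z] is such that the ball of radius [g3] around it in [H] meets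
      every [A]-path of [H].  This ball lies in the ball of radius [d * g3] in
      [G] ([near_of_power]), and for [d > 0] each [A]-path of [G] is one of [H].
      So the larger ball meets every [A]-path of [G]. *)

Set Implicit Arguments.
Unset Strict Implicit.
Unset Printing Implicit Defensive.

(** * Distance through walks *)

(** Repeated vertices are allowed, so that walks can be concatenated without
    shortening them. *)
Definition near (G : sgraph) (r : nat) (x y : G) : Prop :=
  exists p, [/\ path (@edge G) x p, last x p = y & size p <= r].

(** A walk can be shortened to a path, which has fewer than [#|G|] edges, so
    the bounded search in [dist] misses nothing. *)
Lemma dist_leqP (G : sgraph) (X Y : {set G}) (r : nat) :
  reflect (exists x y, [/\ x \in X, y \in Y & near r x y]) (dist_leq X Y r).
Proof.
apply: (iffP idP) => [|[x [y [xX yY [p [xp lastp szp]]]]]].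
  rewrite /dist_leq /dist; set n := find _ _; case: ltnP => // n_lt n_le.
  have hasP : has (path_from_to X Y) (iota 0 #|G|) by rewrite has_find size_iota.
  have := nth_find 0 hasP; rewrite -/n nth_iota // add0n.
  case/exists_inP=> x xX /existsP [p /andP [/andP [xp _] pY]].
  exists x, (last x p); split=> //; exists p; split=> //.
  by rewrite size_tuple.
subst y; case/shortenP: xp yY => q xq uq subqp qY.
have szq : size q <= r.
  by apply: leq_trans szp; case/andP: uq => _ uq; apply: uniq_leq_size.
have ltq : size q < #|G|.
  by rewrite -[(size q).+1]/(size (x :: q)) -(card_uniqP uq) max_card.
have Pq : path_from_to X Y (size q).
  apply/exists_inP; exists x => //; apply/existsP; exists (in_tuple q).
  by rewrite /is_path xq uq qY.
have le_find : find (path_from_to X Y) (iota 0 #|G|) <= size q.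
  rewrite leqNgt; apply/negP => /(before_find 0).
  by rewrite nth_iota // add0n Pq.
by rewrite /dist_leq /dist (leq_ltn_trans le_find ltq) (leq_trans le_find szq).
Qed.

Lemma dist_geqS (G : sgraph) (X Y : {set G}) (d : nat) :
  dist_geq X Y d.+1 = ~~ dist_leq X Y d.
Proof. by rewrite /dist_geq /dist_leq; case: dist => // n; rewrite ltnNge. Qed.

Lemma in_closed_nbhd (G : sgraph) (Z : {set G}) (r : nat) (v : G) :
  v \in closed_nbhd Z r <-> exists2 z, z \in Z & near r z v.
Proof.
rewrite inE; split=> [/exists_inP [z zZ /dist_leqP [x [y []]]]|[z zZ zv]].
  by move=> /set1P -> /set1P -> zv; exists z.
apply/exists_inP; exists z => //; apply/dist_leqP; exists z, v.
by rewrite !set11.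
Qed.

Section Near.

Variable G : sgraph.
Implicit Types x y z : G.

Lemma near_refl r x : near r x x.
Proof. by exists [::]. Qed.

Lemma near_leq r s x y : r <= s -> near r x y -> near s x y.
Proof.
by move=> le_rs [p [xp lp sp]]; exists p; split=> //; apply: leq_trans le_rs.
Qed.

Lemma near_trans r s x y z : near r x y -> near s y z -> near (r + s) x z.
Proof.
move=> [p [xp lp sp]] [q [yq lq sq]]; exists (p ++ q).
by rewrite cat_path last_cat size_cat lp xp yq leq_add.
Qed.

Lemma near_sym r x y : near r x y -> near r y x.
Proof.
move=> [p [xp <- sp]]; exists (rev (belast x p)); split.
- rewrite rev_path; apply: sub_path xp => u v /=.
  by rewrite edge_sym.
- by case: p {xp sp} => //= a p; rewrite rev_cons last_rcons.
- by rewrite size_rev size_belast.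
Qed.

Lemma near_split r s x y :
  near (r + s) x y -> exists2 z, near r x z & near s z y.
Proof.
move=> [p [xp lp sp]]; exists (last x (take r p)).
  exists (take r p); split=> //; first exact: take_path.
  by rewrite size_take_min geq_minl.
exists (drop r p); rewrite -last_cat cat_take_drop; split=> //.
  by move: xp; rewrite -{1}(cat_take_drop r p) cat_path => /andP [].
by rewrite size_drop leq_subLR.
Qed.

(** Each vertex cuts the walk into two parts, one of length at most [d./2]. *)
Lemma walk_near_ends d x y :
  near d x y ->
  exists p, [/\ path (@edge G) x p, last x p = y &
    forall v, v \in x :: p -> near d./2 x v \/ near d./2 y v].
Proof.
move=> [p [xp lp sp]]; exists p; split=> // v vp.
case/splitPl: vp xp lp sp => p1 p2 lp1; rewrite cat_path last_cat size_cat lp1.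
move=> /andP [xp1 vp2] lp2 sz.
case: (leqP (size p1) d./2) => szp1; [left | right].
  by exists p1.
apply: near_sym; exists p2; split=> //.
by move: (size p1) (size p2) sz szp1 => m n; lia.
Qed.

End Near.

(** * Powers of a graph *)

Section Power.

Variables (G : sgraph) (d : nat).
Implicit Types x y : G.

Definition power_edge : rel G :=
  fun x y => (x != y) && dist_leq [set x] [set y] d.

Lemma power_edgeP x y : reflect (x <> y /\ near d x y) (power_edge x y).
Proof.
apply: (iffP andP) => [[/eqP xDy /dist_leqP [u [v []]]]|[/eqP xDy xy]].
  by move=> /set1P -> /set1P ->.
by split=> //; apply/dist_leqP; exists x, y; rewrite !set11.
Qed.

Lemma power_edge_sym : symmetric power_edge.
Proof.
by move=> x y; apply/power_edgeP/power_edgeP => -[xDy xy];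
  split; [exact: nesym | exact: near_sym | exact: nesym | exact: near_sym].
Qed.

Lemma power_edge_irrefl : irreflexive power_edge.
Proof. by move=> x; rewrite /power_edge eqxx. Qed.

Definition power : sgraph := SGraph power_edge_sym power_edge_irrefl.

(** Cutting at an intermediate vertex gives two halves of length at most [d],
    each of which is an edge of the power or trivial. *)
Lemma near_power x y : near (d + d) x y -> @near power 2 x y.
Proof.
have near1 (u v : G) : near d u v -> @near power 1 u v.
  move=> uv; case: (eqVneq u v) => [->|/eqP uDv]; first exact: near_refl.
  by exists [:: v]; split=> //=; rewrite andbT; apply/power_edgeP.
move=> /near_split [z /near1 xz /near1 zy].
exact: near_trans xz zy.
Qed.

Lemma near_of_power r x y : @near power r x y -> near (d * r) x y.
Proof.
move=> [p []]; elim: p r x => [|z p IHp] r x /=.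
  by move=> _ -> _; exact: near_refl.
case: r => // r /andP [/power_edgeP [_ xz] zp] lp sp.
by rewrite mulnS; apply: near_trans xz _; apply: IHp.
Qed.

Lemma closed_nbhd_power (Z : {set G}) (r : nat) :
  @closed_nbhd power Z r \subset closed_nbhd Z (d * r).
Proof.
apply/subsetP=> v /in_closed_nbhd [z zZ zv].
by apply/in_closed_nbhd; exists z => //; apply: near_of_power.
Qed.

(** Each edge of the walk is replaced by a walk of length at most [d] in [G],
    whose vertices are all close to one of its two ends. *)
Lemma walk_of_power x p :
  path power_edge x p ->
  exists q, [/\ path (@edge G) x q, last x q = last x p &
    forall v, v \in x :: q -> exists2 u, u \in x :: p & near d./2 u v].
Proof.
elim: p x => [|y p IHp] x /=.
  by move=> _; exists [::]; split=> // v vx; exists v => //; exact: near_refl.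
case/andP=> /power_edgeP [_ /walk_near_ends [q1 [xq1 lq1 near1]]].
move=> /IHp [q2 [yq2 lq2 near2]]; exists (q1 ++ q2).
rewrite cat_path last_cat lq1 xq1 yq2; split=> // v.
rewrite -cat_cons mem_cat => /orP [/near1 [xv|yv]|vq2].
- by exists x => //; rewrite mem_head.
- by exists y => //; rewrite !inE eqxx orbT.
have [|u up uv] := near2 v; first by rewrite inE vq2 orbT.
by exists u => //; rewrite inE up orbT.
Qed.

(** Cutting the cycles out of the walk of [walk_of_power] keeps its ends, which
    are distinct, so an edge remains. *)
Lemma A_path_of_power (A : {set G}) (s : seq G) :
  @is_A_path power A s ->
  exists2 t, is_A_path A t &
    forall v, v \in t -> exists2 u, u \in s & near d./2 u v.
Proof.
case: s => // x p /and4P [/andP [xp ups] sp xA pA].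
have [q [xq lq nearq]] := walk_of_power xp.
case/shortenP: xq lq => q' xq' uq' subq lq'.
exists (x :: q') => [|v vq']; last first.
  apply: nearq; move: vq'; rewrite !inE => /orP [->//|/subq ->].
  by rewrite orbT.
rewrite /is_A_path /is_path xq' uq' xA lq' pA /= andbT.
(* an empty [q'] would make the ends of the simple path [x :: p] coincide *)
case: q' lq' {xq' uq' subq} => //= lq'.
by case: p sp ups lq' {xp pA nearq} => //= y p _ /andP [xNp _] xE;
  rewrite {1}xE mem_last in xNp.
Qed.

Lemma edge_power x y : 0 < d -> edge x y -> power_edge x y.
Proof.
move=> d_gt0 xy; apply/power_edgeP; split=> [xE|].
  by rewrite xE edge_irrefl in xy.
by exists [:: y]; rewrite /= xy.
Qed.

Lemma A_path_power (A : {set G}) (s : seq G) :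
  0 < d -> is_A_path A s -> @is_A_path power A s.
Proof.
move=> d_gt0; case: s => // x p /and4P [/andP [xp up] sp xA pA].
rewrite /is_A_path /is_path up sp xA pA /= !andbT.
by apply: sub_path xp => u v; apply: edge_power.
Qed.

End Power.

(** * Paths after vertex deletion *)

Lemma is_A_path_del (G : sgraph) (S A : {set G}) (s : seq (del_vertices S)) :
  is_A_path (del_set S A) s = is_A_path A (map val s).
Proof.
case: s => // x p.
have uniqE := map_inj_uniq (@val_inj _ _ {v | v \notin S}) (x :: p).
by rewrite /is_A_path /is_path -uniqE /= path_map size_map last_map !inE.
Qed.

(** Rephrases paths of [G - S] as paths of [G], which allows them to be compared
    with paths of the power of [G] on the same vertices. *)
Lemma del_A_pathP (G : sgraph) (S A : {set G}) :
  (exists s, is_A_path (del_set S A) s) <->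
  (exists2 s : seq G, is_A_path A s & forall x, x \in s -> x \notin S).
Proof.
split=> [[s]|[s As sNS]].
  rewrite is_A_path_del => As; exists (map val s) => // _ /mapP [x _ ->].
  exact: valP x.
exists (pmap insub s : seq (del_vertices S)); rewrite is_A_path_del.
rewrite (pmap_filter (insubK _)) (eq_in_filter (a2 := predT)) ?filter_predT //.
by move=> x /sNS xNS; rewrite isSome_insub.
Qed.

(** * From distance 3 to distance d *)

Theorem mainTheorem4 (f : nat -> nat) (g3 : nat) :
  (forall (k : nat) (G : sgraph) (A : {set G}), 0 < k ->
     has_distant_A_paths A k 3 \/ has_A_path_cover A (f k) g3) ->
  forall (k d : nat) (G : sgraph) (A : {set G}), 0 < k -> 0 < d ->
    has_distant_A_paths A k d \/ has_A_path_cover A (f k) (d * g3).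
Proof.
move=> H3 k d G A k_gt0 d_gt0.
case: (H3 k (power G d) A k_gt0) => [[P [AP distP]]|[Z [szZ coverZ]]];
  [left | right].
  have /fin_all_exists2 [Q AQ nearQ] i := A_path_of_power (AP i).
  exists Q; split=> // i j iDj.
  rewrite -(prednK d_gt0) dist_geqS; apply/negP.
  case/dist_leqP=> u [v []]; rewrite !inE => /nearQ [x xP xu] /nearQ [y yP yv] uv.
  have := distP i j iDj; rewrite dist_geqS => /negP; apply.
  apply/dist_leqP; exists x, y; rewrite !inE; split=> //; apply: near_power.
  (* the walk from [x] to [y] has length at most
     [d./2 + (d.-1 + d./2) <= d + d] *)
  apply: near_leq (near_trans xu (near_trans uv (near_sym yv))).
  lia.
exists Z; split=> // /del_A_pathP [s As sN]; apply: coverZ.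
apply/del_A_pathP; exists s; first exact: A_path_power.
by move=> x /sN; apply: contra; apply/subsetP/closed_nbhd_power.
Qed.
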